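(* Let $\mathbb P$ be a probability measure on $\Omega=[0,\infty)^E$ that is stationary and ergodic under the translations $\{\tau_x\}_{x\in\mathbb Z^d}$, under which there is almost surely a unique infinite cluster $\mathcal C_\infty(\omega)$, and such that $\mathbb E[\mu^\omega(0)]<\infty$ and $\mathbb E\big[\sum_{x\in\mathbb Z^d}\omega(\{0,x\})|x|^2\big]<\infty$. Assume that the corrector satisfies $\chi=\mathrm D\phi$ on $\Omega_0$ for a function $\phi:\Omega_0\to\mathbb R^d$ with $\mathrm D\phi\in L^2_{\mathrm{cov}}(\mathbf P)$, and that for some $\epsilon\ge0$ (the case $\epsilon=0$ being allowed) $$\mathbb E\Big[\sum_{x\in\mathbb Z^d}\omega(\{0,x\})\big(|\phi(\tau_x\omega)|^2+|\phi(\omega)|^{2+\epsilon}\big)\mathbf 1_{\{0\in\mathcal C_\infty(\omega)\}}\Big]<\infty .$$ Then the matrix $\Sigma^2=\big(\langle\Phi^i,\Phi^j\rangle_{L^2_{\mathrm{cov}}(\mathbf P)}\big)_{i,j=1}^d$ is non-degenerate.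
   Context: Setting. Let $d\ge 1$, $E=\{\{x,y\}:x,y\in\mathbb Z^d,\ x\ne y\}$, $\Omega=[0,\infty)^E$ with its Borel $\sigma$-algebra; $\omega(e)$ is the conductance of the edge $e$. Translations: $(\tau_x\omega)(\{u,v\})=\omega(\{u+x,v+x\})$. $\mu^\omega(x)=\sum_{y}\omega(\{x,y\})$. $\mathcal C_x(\omega)$ is the connected component of $x$ in the graph on $\mathbb Z^d$ whose edges are the $e$ with $\omega(e)>0$; $\mathcal C_\infty(\omega)$ is the unique infinite cluster (assumed without loss of generality to exist uniquely for every $\omega$). $\mathbb E$ is expectation under $\mathbb P$. $\Omega_0=\{\omega:0\in\mathcal C_\infty(\omega)\}$, $\mathbf P=\mathbb P(\cdot\mid\Omega_0)$, with expectation $\mathbf E$. Corrector. A measurable $\Psi:\Omega\times\mathbb Z^d\to\mathbb R$ has the cocycle property if for $\mathbb P$-a.e. $\omega$, $\Psi(\tau_x\omega,y-x)=\Psi(\omega,y)-\Psi(\omega,x)$ for all $x,y$ with $y\in\mathcal C_x(\omega)$. $L^2_{\mathrm{cov}}=L^2_{\mathrm{cov}}(\mathbb P)$ is the Hilbert space of $\Psi$ with the cocycle property and finite norm, with scalar product $\langle\Phi,\Psi\rangle_{L^2_{\mathrm{cov}}(\mathbb P)}=\mathbb E[\sum_x\omega(\{0,x\})\Phi(\omega,x)\Psi(\omega,x)]$; $L^2_{\mathrm{cov}}(\mathbf P)$ is the same with $\mathbf E$ in place of $\mathbb E$ (functions on $\Omega_0\times\mathbb Z^d$). For $\varphi:\Omega\to\mathbb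 R$, $\mathrm D\varphi(\omega,x)=\varphi(\tau_x\omega)-\varphi(\omega)$; for $\phi:\Omega_0\to\mathbb R^d$ the same formula is used for $\omega\in\Omega_0$, $x\in\mathcal C_\infty(\omega)$. A local function is bounded and depends on finitely many edges. $L^2_{\mathrm{pot}}$ is the closure in $L^2_{\mathrm{cov}}$ of the gradients $\mathrm D\varphi$ of local functions, and $L^2_{\mathrm{sol}}$ its orthogonal complement in $L^2_{\mathrm{cov}}$. With $\Pi^j(\omega,x)=x^j$, the corrector $\chi=(\chi^1,\dots,\chi^d)$ is defined by: $\chi^j$ is the unique element of $L^2_{\mathrm{pot}}$ such that $\Phi^j:=\Pi^j-\chi^j\in L^2_{\mathrm{sol}}$; $\Phi=(\Phi^1,\dots,\Phi^d)$ are the harmonic coordinates. *)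

(* Defs.v *)
From HB Require Import structures.
From mathcomp Require Import all_boot all_order all_algebra finmap.
From mathcomp Require Import all_classical all_reals all_analysis.
Set Implicit Arguments.
Unset Strict Implicit.
Unset Printing Implicit Defensive.
Import Order.TTheory GRing.Theory Num.Theory.
Import numFieldNormedType.Exports.
Local Open Scope classical_set_scope.
Local Open Scope ring_scope.

Notation Zd d := 'rV[int]_d.

Definition edge (d : nat) := {e : {fset Zd d} | #|` e| == 2%N}.

Lemma shift_edge_card d (x : Zd d) (e : edge d) :
  #|` [fset (u + x)%R | u in val e]%fset| == 2%N.
Proof. by rewrite card_imfset ?(valP e)//; exact: addIr. Qed.

Definition shift_edge d (x : Zd d) (e : edge d) : edge d :=
  exist _ [fset (u + x)%R | u in val e]%fset (shift_edge_card x e).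

(* The half-line [0, +oo[ as a type, with the subspace topology. *)
Definition nnreal (R : realType) := set_type [set r : R | 0 <= r].
HB.instance Definition _ (R : realType) := Topological.on (nnreal R).

Lemma nnreal0_subproof (R : realType) : (0 : R) \in [set r : R | 0 <= r].
Proof. by rewrite inE /=. Qed.

HB.instance Definition _ (R : realType) :=
  isPointed.Build (nnreal R) (exist _ 0 (nnreal0_subproof R)).

(* The environment space [0, +oo[^E: the sigma-algebra is generated by the
   open sets of the product topology. *)
Definition env (d : nat) (R : realType) :=
  g_sigma_algebraType (@open {ptws edge d -> nnreal R}).

Section Environment.
Context {d : nat} {R : realType}.
Implicit Types (w : env d R) (x y : Zd d).

(* The conductance of {x, y}. There is no edge {x, x}, and the value is then 0,
   so that sums over neighbours can range over all of Z^d. *)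
Definition cond w x y : R :=
  if insub [fset x; y]%fset is Some e then set_val (w e) else 0.

Definition tau x w : env d R := fun e => w (shift_edge x e).

Definition mu_env w x : \bar R := \esum_(y in [set: Zd d]) (cond w x y)%:E.

Definition connected_in w x y : Prop :=
  exists2 s : seq (Zd d), path (fun u v => 0 < cond w u v) x s & last x s = y.

Definition cluster w x : set (Zd d) := [set y | connected_in w x y].

Definition infinite_cluster w (C : set (Zd d)) : Prop :=
  (exists x, C = cluster w x) /\ infinite_set C.

(* The union of all infinite clusters, hence the infinite cluster whenever it
   is unique. *)
Definition C_infty w : set (Zd d) :=
  [set x | exists2 C, infinite_cluster w C & C x].

Definition Omega0 : set (env d R) := [set w | C_infty w 0].

Lemma measurable_coord (e : edge d) (A : set (nnreal R)) :
  open A -> measurable [set w : env d R | A (w e)].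
Proof.
move=> oA; apply: sub_sigma_algebra.
have /continuousP : continuous (proj e : {ptws edge d -> nnreal R} -> nnreal R).
  exact: proj_continuous.
exact.
Qed.

Lemma measurable_cond_gt0 x y : measurable [set w : env d R | 0 < cond w x y].
Proof.
rewrite /cond; case: insubP => [e _ _|_]; last first.
  by rewrite (_ : [set _ | _] = set0)//; apply/seteqP; split => // w /=; rewrite ltxx.
apply: (measurable_coord e (A := set_val @^-1` [set r | 0 < r])).
have /continuousP : continuous (set_val : nnreal R -> R).
  exact: initial_continuous.
by apply; exact: open_gt.
Qed.

Lemma measurable_connected x y :
  measurable [set w : env d R | connected_in w x y].
Proof.
rewrite (_ : [set _ | _] = \bigcup_(s : seq (Zd d))
    [set w | path (fun u v => 0 < cond w u v) x s /\ last x s = y]); last first.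
  by apply/seteqP; split=> w /= [s]; [move=> h1 h2|move=> _ [h1 h2]]; exists s.
apply: countable_bigcupT_measurable => // s.
have [sy|sy] := eqVneq (last x s) y; last first.
  rewrite (_ : [set _ | _] = set0)//.
  by apply/seteqP; split => // w /= [_ /eqP]; rewrite (negbTE sy).
rewrite (_ : [set _ | _] =
    [set w : env d R | path (fun u v => 0 < cond w u v) x s]); last first.
  by apply/seteqP; split=> w //= [].
elim: s x {sy} => [|z s ih] x /=.
  by rewrite (_ : [set _ | _] = setT)//; apply/seteqP; split.
rewrite (_ : [set _ | _] = [set w : env d R | 0 < cond w x z] `&`
    [set w | path (fun u v => 0 < cond w u v) z s]).
  by apply: measurableI => //; exact: measurable_cond_gt0.
by apply/seteqP; split=> w /= /andP.
Qed.

Lemma connected_in_sym w x y : connected_in w x y -> connected_in w y x.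
Proof.
case=> s + <-; elim: s x => [|z s ih] x /=; first by exists [::].
move=> /andP[xz /ih [t pt lt]]; exists (rcons t x); last by rewrite last_rcons.
by rewrite rcons_path pt lt /cond fsetUC.
Qed.

Lemma connected_in_trans w x y z :
  connected_in w x y -> connected_in w y z -> connected_in w x z.
Proof.
move=> [s ps <-] [t pt <-]; exists (s ++ t); last by rewrite last_cat.
by rewrite cat_path ps.
Qed.

Lemma C_inftyE w : C_infty w = [set x | infinite_set (cluster w x)].
Proof.
apply/seteqP; split=> x /= => [[C [[y ->] infC] xy]|infx]; last first.
  by exists (cluster w x); [split => //; exists x|exists [::]].
rewrite (_ : cluster w x = cluster w y)//; apply/seteqP; split=> z /= h.
  exact: connected_in_trans h.
by apply: connected_in_trans h; exact: connected_in_sym.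
Qed.

Lemma measurable_Omega0 : measurable Omega0.
Proof.
rewrite (_ : Omega0 = ~` \bigcup_(F : {fset Zd d})
   \bigcap_y [set w | connected_in w 0 y -> y \in F]).
  apply: measurableC; apply: countable_bigcupT_measurable => // F.
  rewrite -[X in measurable X]setCK setC_bigcap; apply: measurableC.
  apply: countable_bigcupT_measurable => // y; apply: measurableC.
  have [yF|yF] := boolP (y \in F).
    by rewrite (_ : [set _ | _] = setT)//; apply/seteqP; split.
  rewrite (_ : [set _ | _] = ~` [set w | connected_in w 0 y]).
    by apply: measurableC; exact: measurable_connected.
  by apply/seteqP; split=> w /= h // /h.
apply/seteqP; split=> w /=; rewrite /Omega0 /= C_inftyE /=.
  move=> infw [F _ hF]; apply: infw; apply: (sub_finite_set _ (finite_fset F)).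
  by move=> y /=; exact: hF.
move=> hw /finite_fsetP[F FE]; apply: hw; exists F => // y _ /= y0.
by rewrite -[is_true _]/([set` F] y) -FE.
Qed.

End Environment.
Arguments Omega0 {d R}.

Section Measures.
Context {d : nat} {R : realType}.

Definition stationary (P : probability (env d R) R) : Prop :=
  forall (x : Zd d) (A : set (env d R)),
    measurable A -> P (tau x @^-1` A) = P A.

Definition ergodic (P : probability (env d R) R) : Prop :=
  forall A : set (env d R), measurable A ->
    (forall x : Zd d, tau x @^-1` A = A) -> P A = 0%E \/ P A = 1%E.

(* P(. | Omega0); [mnormalize] falls back to its last argument when Omega0 is
   negligible, which stationarity and a.s. existence of an infinite cluster exclude. *)
Definition condP (P : probability (env d R) R) : probability (env d R) R :=
  mnormalize (mrestr P measurable_Omega0) P.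

End Measures.

(* [esum] is meaningful for nonnegative terms only. *)
Definition sumZ (d : nat) (R : realType) (f : Zd d -> \bar R) : \bar R :=
  (\esum_(x in [set: Zd d]) f^\+ x - \esum_(x in [set: Zd d]) f^\- x)%E.

Section Covariant.
Context {d : nat} {R : realType}.
Implicit Types (Psi Phi : env d R -> Zd d -> R)
  (Q : {measure set (env d R) -> \bar R}) (A : set (env d R)).

(* In this section functions on A * Z^d, for A a set of environments, are
   represented by total functions whose values outside of A are irrelevant. For
   A = setT and Q = P one gets L^2_cov(P), and for A = Omega0 and
   Q = P(. | Omega0) the space over the conditioned measure. *)
Definition cocycle Q A Psi : Prop :=
  {ae Q, forall w, A w -> forall x y : Zd d, A (tau x w) -> cluster w x y ->
    Psi (tau x w) (y - x) = Psi w y - Psi w x}.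

Definition cov_dot Q A Phi Psi : \bar R :=
  (\int[Q]_(w in A)
     sumZ (fun x : Zd d => (cond w 0 x * Phi w x * Psi w x)%:E))%E.

(* As Z^d is discrete and countable, joint measurability is measurability of
   every section. *)
Definition L2cov Q A Psi : Prop :=
  [/\ forall x : Zd d, measurable_fun A (fun w => Psi w x),
      cocycle Q A Psi & (cov_dot Q A Psi Psi < +oo)%E].

Definition grad (phi : env d R -> R) (w : env d R) (x : Zd d) : R :=
  phi (tau x w) - phi w.

(* The gradient of a function on Omega0: it only makes sense when 0 and x belong
   to the infinite cluster, and is set to 0 elsewhere. *)
Definition grad_infty (phi : env d R -> R) (w : env d R) (x : Zd d) : R :=
  if `[< Omega0 w /\ C_infty w x >] then grad phi w x else 0.

Definition local_fun (phi : env d R -> R) : Prop :=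
  [/\ measurable_fun setT phi,
      exists M : R, forall w, `|phi w| <= M &
      exists F : {fset edge d}, forall w w' : env d R,
        (forall e, e \in F -> w e = w' e) -> phi w = phi w'].

Definition L2pot (P : probability (env d R) R) Psi : Prop :=
  L2cov P setT Psi /\
  forall eps : R, 0 < eps -> exists2 phi, local_fun phi &
    let Delta w x := Psi w x - grad phi w x in
    (cov_dot P setT Delta Delta < (eps ^+ 2)%:E)%E.

Definition L2sol (P : probability (env d R) R) Psi : Prop :=
  L2cov P setT Psi /\
  forall Phi, L2pot P Phi -> cov_dot P setT Phi Psi = 0%E.

Definition harmonic_coord (chi : 'I_d -> env d R -> Zd d -> R) (j : 'I_d)
    (w : env d R) (x : Zd d) : R :=
  (x 0 j)%:~R - chi j w x.

Definition is_corrector (P : probability (env d R) R)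
    (chi : 'I_d -> env d R -> Zd d -> R) : Prop :=
  forall j, L2pot P (chi j) /\ L2sol P (harmonic_coord chi j).

Definition Sigma2 (P : probability (env d R) R)
    (chi : 'I_d -> env d R -> Zd d -> R) : 'M[R]_d :=
  \matrix_(i, j) fine (cov_dot (condP P) Omega0
                         (harmonic_coord chi i) (harmonic_coord chi j)).

(* The library's norm on row vectors is the sup norm. *)
Definition euclid (v : 'rV[R]_d) : R := Num.sqrt (\sum_i v 0 i ^+ 2).

End Covariant.

(* Main.v *)
(** If [v] is a nonzero vector with [v *m Sigma2 = 0], then [v . Phi] vanishes
    almost surely on the open edges at the origin of the infinite cluster, so
    [f := v . phi] satisfies [f (tau x w) - f w = v . x] along these edges. By
    stationarity and uniqueness of the infinite cluster, the value [h w] of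
    [f (tau x w) - v . x] does not depend on the point [x] of the infinite
    cluster. Thus [h] is an almost surely defined random variable with
    [h (tau y w) = h w + v . y], whose law is invariant under translation by
    [v . y]. No probability law on the line has this property unless
    [v . y = 0] for every [y]. *)

Require Import Defs.
From mathcomp Require Import finmap.
From mathcomp Require Import all_boot all_order all_algebra.
From mathcomp Require Import all_classical all_reals all_analysis.
From mathcomp Require Import measurable_realfun ring lra.
Set Implicit Arguments.
Unset Strict Implicit.
Unset Printing Implicit Defensive.
Import Order.TTheory GRing.Theory Num.Theory.
Import numFieldNormedType.Exports.
Local Open Scope classical_set_scope.
Local Open Scope ring_scope.

(** * Sums of nonnegative terms over a countable type *)

Section CountableSums.
Context {R : realType}.
Local Open Scope ereal_scope.

(** Enumerating [I] through [pickle] turns an unordered sum into a series over the naturals, where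
    scaling and measurability follow from the theory of series. *)
Lemma esum_pickle (I : countType) (a : I -> \bar R) : (forall i, 0 <= a i) ->
  \esum_(i in [set: I]) a i =
  \sum_(n <oo | n \in range (@pickle I)) oapp a 0 (unpickle n).
Proof.
move=> a0; have oa0 n : 0 <= oapp a 0 (unpickle n) by case: unpickle => /=.
rewrite nneseries_esum// set_mem_set.
rewrite (@reindex_esum R I nat [set: I] (range (@pickle I)) (@pickle I)).
  by apply: eq_esum => i _; rewrite pickleK.
by apply: inj_bij => ? ? _ _; exact: (pcan_inj pickleK).
Qed.

Lemma esumZ (I : countType) (k : R) (a : I -> \bar R) :
  (0 <= k)%R -> (forall i, 0 <= a i) ->
  \esum_(i in [set: I]) (k%:E * a i) = k%:E * \esum_(i in [set: I]) a i.
Proof.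
move=> k0 a0; rewrite !esum_pickle//; last by move=> i; exact: mule_ge0.
rewrite -nneseriesZl//; last by move=> n _; case: unpickle => /=.
by apply: eq_eseriesr => n _; case: unpickle => //=; rewrite mule0.
Qed.

Lemma measurable_esum d (T : measurableType d) (D : set T) (I : countType)
    (a : T -> I -> \bar R) :
  (forall w i, 0 <= a w i) -> (forall i, measurable_fun D (a ^~ i)) ->
  measurable_fun D (fun w => \esum_(i in [set: I]) a w i).
Proof.
move=> a0 ma; under eq_fun do rewrite esum_pickle//.
apply: ge0_emeasurable_sum => [k w _ _|k _].
  by case: unpickle => /=.
by case: unpickle => /= [i|]; [exact: ma|exact: measurable_cst].
Qed.

End CountableSums.

(** * Linearity of the integral of a signed series over Z^d *)

Section IntegralOfSums.
Context {d : nat} {R : realType} {dT : measure_display} {T : measurableType dT}.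
Variables (mu : {measure set T -> \bar R}) (D : set T).
Hypothesis mD : measurable D.
Implicit Types g a b : T -> Zd d -> R.

Local Notation J a :=
  (\int[mu]_(w in D) \esum_(x in [set: Zd d]) (a w x)%:E)%E.
Local Notation L g := (\int[mu]_(w in D) sumZ (fun x => (g w x)%:E))%E.

Definition msections g := forall x, measurable_fun D (g ^~ x).

Definition abs_summable g := msections g /\ (J (fun w x => `|g w x|) < +oo)%E.

Lemma measurable_esum_fin a : (forall w x, 0 <= a w x) -> msections a ->
  measurable_fun D (fun w => \esum_(x in [set: Zd d]) (a w x)%:E)%E.
Proof.
by move=> a0 ma; apply: measurable_esum => [w x|x]; [rewrite lee_fin|exact/measurable_EFinP].
Qed.

Lemma integral_esum_ge0 a : (forall w x, 0 <= a w x) -> (0 <= J a)%E.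
Proof. by move=> a0; apply: integral_ge0 => w _; apply: esum_ge0 => x _; rewrite lee_fin. Qed.

Lemma integral_esumD a b :
  (forall w x, 0 <= a w x) -> msections a ->
  (forall w x, 0 <= b w x) -> msections b ->
  J (fun w x => a w x + b w x) = (J a + J b)%E.
Proof.
move=> a0 ma b0 mb; rewrite -ge0_integralD//.
- apply: eq_integral => w _; rewrite -esumD//.
  + by move=> x _; rewrite lee_fin.
  + by move=> x _; rewrite lee_fin.
- by move=> w _; apply: esum_ge0 => x _; rewrite lee_fin.
- exact: measurable_esum_fin.
- by move=> w _; apply: esum_ge0 => x _; rewrite lee_fin.
- exact: measurable_esum_fin.
Qed.

Lemma integral_esumZ (k : R) a :
  0 <= k -> (forall w x, 0 <= a w x) -> msections a ->
  J (fun w x => k * a w x) = (k%:E * J a)%E.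
Proof.
move=> k0 a0 ma; rewrite -ge0_integralZl//.
- apply: eq_integral => w _; rewrite -esumZ// => x; rewrite lee_fin; exact: a0.
- exact: measurable_esum_fin.
- by move=> w _; apply: esum_ge0 => x _; rewrite lee_fin.
Qed.

Lemma le_integral_esum a b :
  (forall w x, 0 <= a w x) -> msections a -> msections b ->
  (forall w x, a w x <= b w x) -> (J a <= J b)%E.
Proof.
move=> a0 ma mb ab; apply: ge0_le_integral => //.
- by move=> w _; apply: esum_ge0 => x _; rewrite lee_fin.
- exact: measurable_esum_fin.
- by apply: measurable_esum_fin => // w x; exact: le_trans (ab w x).
- by move=> w _; apply: le_esum => x _; rewrite lee_fin.
Qed.

Lemma integrable_esum a : (forall w x, 0 <= a w x) -> msections a ->
  (J a < +oo)%E ->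
  mu.-integrable D (fun w => \esum_(x in [set: Zd d]) (a w x)%:E)%E.
Proof.
move=> a0 ma Ja; apply/integrableP; split; first exact: measurable_esum_fin.
apply: le_lt_trans Ja; rewrite le_eqVlt; apply/orP; left; apply/eqP.
by apply: eq_integral => w _; rewrite gee0_abs// esum_ge0// => x _; rewrite lee_fin.
Qed.

Lemma msections_abs g : msections g -> msections (fun w x => `|g w x|).
Proof. by move=> mg x; apply: measurableT_comp => //; exact: mg. Qed.

(** [sumZ] uses the positive and negative parts of [a - b], which in general differ from [a] and
    [b]. Since both integrals are finite, both series converge almost everywhere, and there the two
    ways of subtracting agree. *)
Lemma integral_sumZ_decomp a b :
  (forall w x, 0 <= a w x) -> msections a -> (J a < +oo)%E ->
  (forall w x, 0 <= b w x) -> msections b -> (J b < +oo)%E ->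
  L (fun w x => a w x - b w x) = (J a - J b)%E.
Proof.
move=> a0 ma Ja b0 mb Jb.
have ia := integrable_esum a0 ma Ja; have ib := integrable_esum b0 mb Jb.
rewrite -(integralB mD ia ib); apply: ae_eq_integral => //.
- have mab x : measurable_fun D (fun w => (a w x - b w x)%:E).
    by apply/measurable_EFinP; apply: measurable_funB; [exact: ma|exact: mb].
  apply: emeasurable_funB; apply: measurable_esum => // x.
  + rewrite [X in measurable_fun _ X](_ : _ = (fun w => (a w x - b w x)%:E)^\+%E).
      exact: measurable_funepos.
    by apply/funext => w; rewrite !funeposE.
  + rewrite [X in measurable_fun _ X](_ : _ = (fun w => (a w x - b w x)%:E)^\-%E).
      exact: measurable_funeneg.
    by apply/funext => w; rewrite !funenegE.
- by apply: emeasurable_funB; exact: measurable_esum_fin.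
(* Outside a null set both sums are finite, so no difference of infinities arises. *)
- have := integrable_ae mD ia; have := integrable_ae mD ib.
  apply: filterS2 => w fb fa Dw; rewrite /sumZ.
  have sm (c : T -> Zd d -> R) : (forall w x, 0 <= c w x) ->
      (D w -> (\esum_(x in [set: Zd d]) (c w x)%:E)%E \is a fin_num) ->
      summable [set: Zd d] (fun x => (c w x)%:E).
    move=> c0 /(_ Dw) fc; rewrite /summable.
    under eq_esum => x _ do rewrite gee0_abs ?lee_fin//.
    by rewrite ltey_eq fc.
  apply: (@esumB R _ setT (EFin \o a w) (EFin \o b w)); [exact: sm|exact: sm| |].
    by move=> x _; rewrite lee_fin.
  by move=> x _; rewrite lee_fin.
Qed.

Definition summable_nonneg a :=
  [/\ (forall w x, 0 <= a w x), msections a & (J a < +oo)%E].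

(** Any splitting into two nonnegative summable families will do. The choice [|g| + g] and [|g|]
    needs only sums for measurability, and the first part is at most [2|g|]. *)
Lemma abs_summable_decomp g : abs_summable g ->
  exists a b, [/\ summable_nonneg a, summable_nonneg b &
    g = (fun w x => a w x - b w x)].
Proof.
move=> [mg Jg]; exists (fun w x => `|g w x| + g w x), (fun w x => `|g w x|).
have mb : msections (fun w x => `|g w x|) by exact: msections_abs.
have a0 w x : 0 <= `|g w x| + g w x.
  by rewrite -lerBlDr sub0r -normrN ler_norm.
have ma : msections (fun w x => `|g w x| + g w x).
  by move=> x; apply: measurable_funD; [exact: mb|exact: mg].
split; [split => //|split => //|]; last first.
  by apply/funext => w; apply/funext => x; rewrite addrAC subrr add0r.
apply: (@le_lt_trans _ _ (J (fun w x => `|g w x| + `|g w x|))).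
  apply: le_integral_esum => //.
    by move=> x; apply: measurable_funD; exact: mb.
  by move=> w x; rewrite lerD2l ler_norm.
by rewrite integral_esumD// lte_add_pinfty.
Qed.

Lemma summable_nonnegD a b : summable_nonneg a -> summable_nonneg b ->
  summable_nonneg (fun w x => a w x + b w x).
Proof.
move=> [a0 ma Ja] [b0 mb Jb]; split.
- by move=> w x; rewrite addr_ge0.
- by move=> x; apply: measurable_funD; [exact: ma|exact: mb].
- by rewrite integral_esumD// lte_add_pinfty.
Qed.

Lemma summable_nonnegZ k a : 0 <= k -> summable_nonneg a ->
  summable_nonneg (fun w x => k * a w x).
Proof.
move=> k0 [a0 ma Ja]; split.
- by move=> w x; rewrite mulr_ge0.
- by move=> x; apply: measurable_funM; [exact: measurable_cst|exact: ma].
- by rewrite integral_esumZ// lte_mul_pinfty ?lee_fin.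
Qed.

Lemma abs_summableD g h : abs_summable g -> abs_summable h ->
  abs_summable (fun w x => g w x + h w x).
Proof.
move=> [mg Jg] [mh Jh].
have mgh : msections (fun w x => g w x + h w x).
  by move=> x; apply: measurable_funD; [exact: mg|exact: mh].
split => //; apply: le_lt_trans (lte_add_pinfty Jg Jh).
rewrite -integral_esumD//; try exact: msections_abs.
apply: le_integral_esum => //.
- exact: msections_abs.
- by move=> x; apply: measurable_funD; exact: msections_abs.
- by move=> w x; exact: ler_normD.
Qed.

Lemma abs_summableZ k g : abs_summable g -> abs_summable (fun w x => k * g w x).
Proof.
move=> [mg Jg]; split.
  by move=> x; apply: measurable_funM; [exact: measurable_cst|exact: mg].
rewrite [ltLHS](_ : _ = J (fun w x => `|k| * `|g w x|)).
  rewrite integral_esumZ//; last exact: msections_abs.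
  rewrite lte_mul_pinfty ?lee_fin//.
by apply: eq_integral => w _; apply: eq_esum => x _; rewrite normrM.
Qed.

Lemma abs_summable_le g h : msections g -> (forall w x, `|g w x| <= h w x) ->
  msections h -> (J h < +oo)%E -> abs_summable g.
Proof.
move=> mg gh mh Jh; split => //; apply: le_lt_trans Jh.
by apply: le_integral_esum => //; exact: msections_abs.
Qed.

Lemma fine_integral_sumZ_decomp a b : summable_nonneg a -> summable_nonneg b ->
  fine (L (fun w x => a w x - b w x)) = fine (J a) - fine (J b).
Proof.
move=> [a0 ma Ja] [b0 mb Jb]; rewrite integral_sumZ_decomp// fineB//.
  by rewrite ge0_fin_numE//; exact: integral_esum_ge0.
by rewrite ge0_fin_numE//; exact: integral_esum_ge0.
Qed.

Lemma fine_integral_esumD a b : summable_nonneg a -> summable_nonneg b ->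
  fine (J (fun w x => a w x + b w x)) = fine (J a) + fine (J b).
Proof.
move=> [a0 ma Ja] [b0 mb Jb]; rewrite integral_esumD// fineD//.
  by rewrite ge0_fin_numE//; exact: integral_esum_ge0.
by rewrite ge0_fin_numE//; exact: integral_esum_ge0.
Qed.

Lemma fine_integral_esumZ k a : 0 <= k -> summable_nonneg a ->
  fine (J (fun w x => k * a w x)) = k * fine (J a).
Proof.
move=> k0 [a0 ma Ja]; rewrite integral_esumZ// fineM//.
by rewrite ge0_fin_numE//; exact: integral_esum_ge0.
Qed.

(** Since the value does not depend on the splitting chosen, [(a - b) + (c - e)] may be regrouped as
    [(a + c) - (b + e)], which reduces the claim to additivity for nonnegative families. *)
Lemma fine_integral_sumZD g h : abs_summable g -> abs_summable h ->
  fine (L (fun w x => g w x + h w x)) = fine (L g) + fine (L h).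
Proof.
move=> /abs_summable_decomp[a [b [sa sb ->]]].
move=> /abs_summable_decomp[c [e [sc se ->]]].
rewrite (fine_integral_sumZ_decomp sa sb) (fine_integral_sumZ_decomp sc se).
transitivity (fine (L (fun w x => (a w x + c w x) - (b w x + e w x)))).
  congr fine; apply: eq_integral => w _; congr sumZ.
  by apply/funext => x; congr EFin; ring.
rewrite (fine_integral_sumZ_decomp (summable_nonnegD sa sc) (summable_nonnegD sb se)).
by rewrite (fine_integral_esumD sa sc) (fine_integral_esumD sb se); ring.
Qed.

Lemma fine_integral_sumZZ k g : abs_summable g ->
  fine (L (fun w x => k * g w x)) = k * fine (L g).
Proof.
move=> /abs_summable_decomp[a [b [sa sb ->]]].
rewrite (fine_integral_sumZ_decomp sa sb).
have [k0|k0] := leP 0 k.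
  transitivity (fine (L (fun w x => k * a w x - k * b w x))).
    congr fine; apply: eq_integral => w _; congr sumZ.
    by apply/funext => x; congr EFin; ring.
  rewrite (fine_integral_sumZ_decomp (summable_nonnegZ k0 sa) (summable_nonnegZ k0 sb)).
  by rewrite (fine_integral_esumZ k0 sa) (fine_integral_esumZ k0 sb); ring.
(* For negative [k] the two parts exchange roles, so that both are scaled by [- k]. *)
have {}k0 : 0 <= - k by rewrite oppr_ge0 ltW.
transitivity (fine (L (fun w x => - k * b w x - (- k) * a w x))).
  congr fine; apply: eq_integral => w _; congr sumZ.
  by apply/funext => x; congr EFin; ring.
rewrite (fine_integral_sumZ_decomp (summable_nonnegZ k0 sb) (summable_nonnegZ k0 sa)).
by rewrite (fine_integral_esumZ k0 sa) (fine_integral_esumZ k0 sb); ring.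
Qed.

(** Summability is proved together with the formula because the induction step needs it for the tail
    of the sum. *)
Lemma fine_integral_sumZ_sum (I : eqType) (s : seq I) (c : I -> R) (g : I -> T -> Zd d -> R) :
  (forall i, abs_summable (g i)) ->
  abs_summable (fun w x => \sum_(i <- s) c i * g i w x) /\
  fine (L (fun w x => \sum_(i <- s) c i * g i w x)) =
    \sum_(i <- s) c i * fine (L (g i)).
Proof.
move=> sg.
have e0 (h : T -> Zd d -> R) : (forall w x, h w x = 0) -> abs_summable h /\ fine (L h) = 0.
  move=> h0; split; [split|].
  - by move=> x; under eq_fun do rewrite h0; exact: measurable_cst.
  - rewrite integral0_eq ?ltry// => w _; apply: esum1 => x _.
    by rewrite h0 normr0.
  - rewrite integral0_eq// => w _; rewrite /sumZ !esum1 ?subee//.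
      by move=> x _; rewrite funenegE h0 oppe0 maxxx.
    by move=> x _; rewrite funeposE h0 maxxx.
elim: s => [|i s [ih1 ih2]].
  by have [] := e0 (fun w x => \sum_(i <- [::]) c i * g i w x)
    (fun=> fun=> big_nil _ _ _ _); rewrite big_nil.
have -> : (fun w x => \sum_(j <- i :: s) c j * g j w x) =
    (fun w x => c i * g i w x + \sum_(j <- s) c j * g j w x).
  by apply/funext => w; apply/funext => x; rewrite big_cons.
have sci := abs_summableZ (c i) (sg i); split; first exact: (abs_summableD sci ih1).
rewrite big_cons -ih2 -(fine_integral_sumZZ _ (sg i)).
rewrite -[RHS](fine_integral_sumZD sci ih1); congr fine.
by apply: eq_integral => w _; congr sumZ; apply/funext => x; rewrite big_cons.
Qed.

End IntegralOfSums.

(** * Translations: measurability, composition, action on conductances and clusters *)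

Lemma ptws_continuous_comp (I J : eqType) (T : topologicalType) (s : J -> I) :
  continuous ((fun w j => w (s j)) : {ptws I -> T} -> {ptws J -> T}).
Proof.
move=> w.
(* Convergence in the product is convergence of each coordinate, and coordinate [j] of the map is
   the projection at [s j]. *)
apply/(@cvg_sup (J -> T) J (fun i => Topological.class
    (initial_topology (fun f : (J -> T) => f i)))).
  exact: (@fmap_filter _ _ _ _ (@nbhs_filter {ptws I -> T} w)).
move=> j.
apply: (@continuous_comp_initial _ {ptws I -> T} T (fun f : J -> T => f j)
  ((fun w j => w (s j)) : {ptws I -> T} -> (J -> T))).
move=> u.
exact: (@proj_continuous _ (fun=> T) (s j)).
Qed.

Section Translations.
Context {d : nat} {R : realType}.
Implicit Types (w : env d R) (x y z : Zd d).

Lemma cond_ge0 w x y : 0 <= cond w x y.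
Proof.
by rewrite /cond; case: insubP => // e _ _; have := set_valP (w e).
Qed.

Lemma measurable_cond x y : measurable_fun [set: env d R] (fun w => cond w x y).
Proof.
rewrite /cond; case: insubP => [e _ _|_]; last exact: measurable_cst.
apply: (measurability (@RGenOInfty.G R)); first exact: RGenOInfty.measurableE.
move=> _ [_ [r ->] <-]; rewrite setTI.
apply: (measurable_coord e (A := set_val @^-1` [set` `]r, +oo[])).
have /continuousP : continuous (set_val : nnreal R -> R).
  exact: initial_continuous.
by apply; exact: interval_open.
Qed.

Lemma continuous_tau x :
  continuous (tau x : {ptws edge d -> nnreal R} -> {ptws edge d -> nnreal R}).
Proof. exact: ptws_continuous_comp. Qed.

Lemma measurable_tau x : measurable_fun [set: env d R] (tau x).
Proof.
apply: (@measurability _ _ (env d R) (env d R) setT (tau x)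
  (@open {ptws edge d -> nnreal R})) => //.
move=> _ [A oA <-]; rewrite setTI; apply: sub_sigma_algebra.
by have /continuousP := @continuous_tau x; exact.
Qed.

Lemma measurable_tau_preimage x (A : set (env d R)) :
  measurable A -> measurable (tau x @^-1` A).
Proof. by move=> mA; rewrite -[X in measurable X]setTI; exact: measurable_tau. Qed.

Lemma tau0 w : tau 0 w = w.
Proof.
apply/funext => e; rewrite /tau; congr (w _); apply/val_inj => /=.
apply/fsetP => u; apply/imfsetP/idP => [[v /= ve ->]|ue]; first by rewrite addr0.
by exists u => //; rewrite addr0.
Qed.

Lemma tauD x y w : tau x (tau y w) = tau (x + y) w.
Proof.
apply/funext => e; rewrite /tau; congr (w _); apply/val_inj => /=.
apply/fsetP => u; apply/imfsetP/imfsetP => /= -[v]; last first.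
  move=> ve ->; exists (v + x); last by rewrite addrA.
  by apply/imfsetP; exists v.
by move=> /imfsetP[v' /= ve' ->] ->; exists v' => //; rewrite addrA.
Qed.

Lemma cond_tau w x y z : cond (tau z w) x y = cond w (x + z) (y + z).
Proof.
have shiftE : [fset (u + z)%R | u in [fset x; y]]%fset = [fset (x + z)%R; (y + z)%R]%fset.
  by rewrite imfsetU !imfset_fset1.
(* For [x = y] the set is a singleton and not an edge, so both sides take the default value 0. *)
have [xy|xy] := eqVneq x y.
  by rewrite /cond xy !fsetUid !insubN// cardfs1.
have c2 (a b : Zd d) : a != b -> #|` [fset a; b]%fset| == 2%N.
  by move=> ab; rewrite cardfs2 ab.
rewrite /cond (insubT (fun e : {fset Zd d} => #|` e| == 2%N) (c2 _ _ xy)).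
have xyz : x + z != y + z by rewrite (inj_eq (addIr z)).
rewrite (insubT (fun e : {fset Zd d} => #|` e| == 2%N) (c2 _ _ xyz)).
by rewrite /tau; congr (set_val (w _)); apply/val_inj; exact: shiftE.
Qed.

Lemma connected_in_tau w x y z :
  connected_in (tau z w) x y -> connected_in w (x + z) (y + z).
Proof.
case=> s + <-; elim: s x => [|u s ih] x /=; first by exists [::].
move=> /andP[xu /ih [t pt lt]]; exists (u + z :: t) => //=.
by rewrite pt andbT -cond_tau.
Qed.

Lemma cluster_tau w x z :
  Defs.cluster (tau z w) x = [set y | Defs.cluster w (x + z) (y + z)].
Proof.
apply/seteqP; split => y /=; first exact: connected_in_tau.
(* The converse inclusion is the direct one for the shift [- z] of the environment [tau z w]. *)
rewrite -{1}[w]tau0 -{1}(addNr z) -tauD => /connected_in_tau.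
by rewrite -!addrA !addrN !addr0.
Qed.

Lemma C_infty_tau w x z : C_infty (tau z w) x <-> C_infty w (x + z).
Proof.
rewrite !C_inftyE /= cluster_tau; split => inf fin; apply: inf.
  apply: (sub_finite_set _ (finite_image (fun y => y - z) fin)) => y /= h.
  by exists (y + z) => //; rewrite addrK.
apply: (sub_finite_set _ (finite_image (fun y => y + z) fin)) => y /= h.
by exists (y - z) => /=; rewrite subrK.
Qed.

Lemma Omega0_tau w x : Omega0 (tau x w) <-> C_infty w x.
Proof. by rewrite /Omega0 /= (C_infty_tau w 0 x) add0r. Qed.

Lemma C_infty_adj w x y : C_infty w x -> 0 < cond w x y -> C_infty w y.
Proof.
rewrite !C_inftyE /= => infx xy finy; apply: infx.
apply: sub_finite_set finy => v; apply: connected_in_trans.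
by apply: connected_in_sym; exists [:: y] => //=; rewrite xy.
Qed.

End Translations.

(** * Almost sure statements under stationarity, and the translation argument *)

Lemma ae_countable_forall dT (T : measurableType dT) (R : realType)
    (mu : {measure set T -> \bar R}) (I : countType) (Q : I -> T -> Prop) :
  (forall i, {ae mu, forall w, Q i w}) -> {ae mu, forall w, forall i, Q i w}.
Proof.
move=> aeQ.
have : {ae mu, forall w, forall n, oapp (fun i => Q i w) True (unpickle n)}.
  apply: ae_foralln => n; case: (unpickle n) => [i|] /=; first exact: aeQ.
  exact: aeW.
by apply: filterS => w Qw i; have := Qw (pickle i); rewrite pickleK.
Qed.

Lemma ae_False dT (T : measurableType dT) (R : realType)
    (mu : probability T R) : ~ {ae mu, forall w : T, False}.
Proof.
move=> [N [mN muN subN]]; have : mu setT = 0%E.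
  apply/eqP; rewrite eq_le measure_ge0 andbT -muN le_measure ?inE//.
  by move=> w _; apply: subN => -[].
by rewrite probability_setT => -[] /eqP; rewrite oner_eq0.
Qed.

Section Stationary.
Context {d : nat} {R : realType}.
Variable P : probability (env d R) R.
Hypothesis statP : stationary P.
Implicit Types (w : env d R) (x y z : Zd d).

Lemma ae_tau (Q : env d R -> Prop) x :
  {ae P, forall w, Q w} -> {ae P, forall w, Q (tau x w)}.
Proof.
move=> [N [mN PN QN]]; exists (tau x @^-1` N); split.
- exact: measurable_tau_preimage.
- by rewrite statP.
- by move=> w /= nQ; exact: QN.
Qed.

Hypothesis uniqueP : {ae P, forall w : env d R, exists! C, infinite_cluster w C}.

(** If the origin were almost surely outside every infinite cluster, then by stationarity so would
    be all lattice points simultaneously, contradicting the existence of an infinite cluster. *)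
Lemma probability_Omega0_neq0 : P Omega0 != 0%E.
Proof.
apply/eqP => P0.
have aeN : {ae P, forall w, ~ Omega0 w}.
  by exists Omega0; split => //; [exact: measurable_Omega0|move=> w /= /contrapT].
apply: (ae_False (mu := P)).
move: uniqueP (ae_countable_forall (fun x => ae_tau x aeN)).
apply: filterS2 => w [C [[[x Cx] infC] _]] nO; apply: (nO x); apply/Omega0_tau.
by exists C; [split => //; exists x|rewrite Cx; exists [::]].
Qed.

(** The variable [h] is handled only through its upper level events, which are defined for every
    environment. Shifting by [y] shows that each strip [t < h <= t + l y] is null, yet countably
    many such strips cover the line. *)
Lemma linear_gradient_eq0 (f : env d R -> R) (l : Zd d -> R) :
  measurable_fun Omega0 f -> {morph l : x y / x + y} ->
  {ae P, forall w, Omega0 w -> forall x, 0 < cond w 0 x ->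
    f (tau x w) - f w = l x} ->
  forall y, l y = 0.
Proof.
move=> mf lD aef y.
have l0 : l 0 = 0 by apply: (addrI (l 0)); rewrite -lD !addr0.
have lN x : l (- x) = - l x by apply: (addrI (l x)); rewrite -lD !subrr l0.
(* Replacing [y] by [- y] changes the sign of [l y]. *)
wlog ly : y / 0 < l y.
  move=> wl; have [ly0|ly0|//] := ltgtP (l y) 0; last exact: wl.
  by apply: oppr_inj; rewrite -lN oppr0; apply: wl; rewrite lN oppr_gt0.
(* [A t] is the event [h > t]. *)
pose A t := [set w | exists x, Omega0 (tau x w) /\ t < f (tau x w) - l x].
have mA t : measurable (A t).
  (* As [f] is measurable on [Omega0] only, each event is pulled back from a subset of [Omega0]. *)
  rewrite (_ : A t = \bigcup_x (tau x @^-1` (Omega0 `&` f @^-1` `]t + l x, +oo[))).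
    apply: countable_bigcupT_measurable => // x.
    apply: measurable_tau_preimage; apply: mf => //; exact: measurable_Omega0.
  apply/seteqP; split => w /= [x].
    by move=> [Ow lt_h]; exists x => //; split => //=; rewrite in_itv/= andbT -ltrBrDr.
  by move=> _ [Ow /=]; rewrite in_itv/= andbT -ltrBrDr => h; exists x.
(* This is [h (tau y w) = h w + l y] in terms of events. It holds for every [w], by reindexing the
   witness [x] to [x + y]. *)
have tauA t : tau y @^-1` A (t + l y) = A t.
  apply/seteqP; split => w /= [x].
    rewrite tauD => -[Ow h]; exists (x + y); split => //.
    by rewrite lD opprD addrA ltrBrDr.
  move=> [Ow h]; exists (x - y); rewrite tauD subrK; split => //.
  by rewrite lD lN opprD opprK addrA ltrD2r.
(* The two events are nested and, by [tauA] and stationarity, have the same finite probability. *)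
have PA t : P (A t `\` A (t + l y)) = 0%E.
  rewrite measureD//; last by rewrite (le_lt_trans (probability_le1 _ (mA t)))// ltry.
  rewrite setIidr; last first.
    move=> w [x [Ow h]]; exists x; split => //; apply: lt_trans h.
    by rewrite ltrDl.
  rewrite [X in (_ - X)%E](_ : _ = P (A t)); last first.
    by rewrite -[in RHS](tauA t); exact/esym/statP.
  by rewrite subee// fin_num_measure.
have aeA (k : int) : {ae P, forall w, ~ (A (k%:~R * l y) `\` A (k%:~R * l y + l y)) w}.
  exists (A (k%:~R * l y) `\` A (k%:~R * l y + l y)); split => //.
  - exact: measurableD.
  - by move=> w /= /contrapT.
(* The hypothesis concerns edges at the origin; its translates cover the edges at every point of the
   infinite cluster. *)
have aeall := ae_countable_forall (fun x => ae_tau x aef).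
exfalso; apply: (ae_False (mu := P)).
  move: (ae_countable_forall aeA) aeall uniqueP.
  apply: filterS3 => w hA hf [C [[[x0 Cx0] infC] uniq]].
  have step x z : C_infty w x -> 0 < cond w x z ->
      f (tau z w) - l z = f (tau x w) - l x.
    move=> Cx xz; have := hf x; move=> /(_ (proj2 (Omega0_tau w x) Cx) (z - x)).
    rewrite cond_tau add0r subrK tauD subrK lD lN => /(_ xz) E.
    by apply/eqP; rewrite -subr_eq0; apply/eqP; move: E => /eqP; rewrite -subr_eq0 => /eqP <-; ring.
  have const x z : C_infty w x -> Defs.cluster w x z ->
      f (tau z w) - l z = f (tau x w) - l x.
    move=> Cx [s + <-]; elim: s x Cx => [//|u s ih] x Cx /= /andP[xu pu].
    rewrite ih//; first exact: step.
    exact: C_infty_adj xu.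
  have Cx0' : C_infty w x0.
    by exists C; [split => //; exists x0|rewrite Cx0; exists [::]].
  (* Uniqueness places every point of [C_infty w] in the cluster of [x0], along which the value is
     constant. *)
  have const0 z : C_infty w z -> f (tau z w) - l z = f (tau x0 w) - l x0.
    move=> [C' infC' C'z]; apply: const => //.
    by rewrite -Cx0 (uniq _ infC').
  set h := f (tau x0 w) - l x0 in const0.
  (* The ceiling minus one gives [k < h / l y <= k + 1]: strict on the left and large on the right,
     as in the difference of two events [h > t]. *)
  pose k := Num.ceil (h / l y) - 1.
  have /andP[kh hk] : (k%:~R < h / l y <= (k + 1)%:~R).
    by rewrite /k subrK ceil_itv.
  apply: (hA k); split.
    by exists x0; split; [exact/Omega0_tau|rewrite -/h -ltr_pdivlMr].
  move=> [z [/Omega0_tau /const0 ->]]; apply/negP; rewrite -leNgt.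
  by move: hk; rewrite ler_pdivrMr// intrD mulrDl mul1r.
Qed.

End Stationary.

(** * Nonnegative series, and conditioning on [Omega0] *)

Lemma sumZ_ge0 d (R : realType) (f : Zd d -> \bar R) :
  (forall x, 0 <= f x)%E -> sumZ f = (\esum_(x in [set: Zd d]) f x)%E.
Proof.
move=> f0; rewrite /sumZ [X in (_ - X)%E]esum1 ?sube0.
  by apply: eq_esum => x _; rewrite funeposE (max_idPl _).
by move=> x _; rewrite funenegE (max_idPr _)// oppe_le0.
Qed.

Lemma le_esum_term (R : realType) (I : choiceType) (a : I -> \bar R) i :
  (forall j, 0 <= a j)%E -> (a i <= \esum_(j in [set: I]) a j)%E.
Proof.
move=> a0; apply: esum_ge; exists [set i]; first by split.
by rewrite fsbig_set1.
Qed.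

Section Conditioning.
Context {d : nat} {R : realType}.
Variable P : probability (env d R) R.
Hypothesis P0 : P Omega0 != 0%E.

Lemma fine_Omega0_gt0 : 0 < fine (P Omega0).
Proof.
rewrite fine_gt0// lt0e P0 measure_ge0/=.
by rewrite (le_lt_trans (probability_le1 _ measurable_Omega0))// ltry.
Qed.

Lemma inv_Omega0_ge0 : 0 <= (fine (P Omega0))^-1.
Proof. by rewrite invr_ge0 ltW// fine_Omega0_gt0. Qed.

(** Positive and finite mass of [Omega0] rules out the fallback of [mnormalize], so that inside
    [Omega0] the conditioned measure is a constant multiple of [P]. *)
Lemma condPE (A : set (env d R)) : A `<=` Omega0 ->
  condP P A = mscale (NngNum inv_Omega0_ge0) P A.
Proof.
move=> AO; rewrite -[LHS]/(mnormalize (mrestr P measurable_Omega0) P A).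
have Poo : P Omega0 != +oo%E.
  by rewrite lt_eqF// (le_lt_trans (probability_le1 _ measurable_Omega0))// ltry.
rewrite /mnormalize/= /mrestr setTI (negbTE P0) (negbTE Poo)/=.
by rewrite (setIidl AO) /mscale/= muleC.
Qed.

(** Only the part of the exceptional set inside [Omega0] matters, and there the two measures differ
    by a positive factor. *)
Lemma ae_condP (B : env d R -> Prop) :
  {ae condP P, forall w, Omega0 w -> B w} -> {ae P, forall w, Omega0 w -> B w}.
Proof.
move=> [N [mN QN NB]]; exists (N `&` Omega0).
have mN0 : measurable (N `&` Omega0).
  by apply: measurableI => //; exact: measurable_Omega0.
split => //; last first.
  move=> w /= nB; split; last by apply: contrapT => nO; exact: nB.
  exact: NB.
have : condP P (N `&` Omega0) = 0%E.
  apply/eqP; rewrite eq_le measure_ge0 andbT -QN.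
  by apply: le_measure; rewrite ?inE//; exact: subIsetl.
rewrite condPE; last exact: subIsetr.
move=> /eqP; rewrite mule_eq0 => /orP[/eqP[/eqP]|/eqP//].
by rewrite invr_eq0 gt_eqF// fine_Omega0_gt0.
Qed.

Lemma integral_condP_lty (f : env d R -> \bar R) :
  measurable_fun setT f -> (forall w, 0 <= f w)%E ->
  (\int[P]_w f w < +oo)%E -> (\int[condP P]_(w in Omega0) f w < +oo)%E.
Proof.
move=> mf f0 Pf.
rewrite (eq_measure_integral (mscale (NngNum inv_Omega0_ge0) P)); last first.
  by move=> A mA AO; exact: condPE.
rewrite ge0_integral_mscale//; last 2 first.
- exact: measurable_Omega0.
- exact: measurable_funTS.
rewrite lte_mul_pinfty ?lee_fin ?inv_Omega0_ge0//.
apply: le_lt_trans Pf; apply: ge0_subset_integral => //.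
exact: measurable_Omega0.
Qed.

End Conditioning.

(** * Null vectors of a Gram matrix *)

Section QuadraticForm.
Context {d : nat} {R : realType}.
Variable Q : {measure set (env d R) -> \bar R}.
Variable D : set (env d R).
Hypothesis mD : measurable D.
Variable F : 'I_d -> env d R -> Zd d -> R.
Hypothesis mF : forall i x, measurable_fun D (F i ^~ x).
Hypothesis F2 : forall i,
  (\int[Q]_(w in D)
     (\esum_(x in [set: Zd d]) (cond w 0 x * F i w x ^+ 2)%:E) < +oo)%E.

Let g i j w x := cond w 0 x * F i w x * F j w x.

Lemma msections_cond_mul i j : msections D (g i j).
Proof.
move=> x; apply: measurable_funM; last exact: mF.
by apply: measurable_funM; [exact: measurable_funTS (measurable_cond 0 x)|exact: mF].
Qed.

Lemma summable_nonneg_cond_sqr i :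
  summable_nonneg Q D (fun w x => cond w 0 x * F i w x ^+ 2).
Proof.
split => //; first by move=> w x; rewrite mulr_ge0 ?cond_ge0 ?sqr_ge0.
move=> x; apply: eq_measurable_fun (msections_cond_mul i i x) => w _.
by rewrite /g expr2 mulrA.
Qed.

(** Domination by the diagonal terms: [|ab| <= a^2 + b^2], weighted by the conductance. *)
Lemma abs_summable_cond_mul i j : abs_summable Q D (g i j).
Proof.
have [h0 mh Jh] := summable_nonnegD mD (summable_nonneg_cond_sqr i) (summable_nonneg_cond_sqr j).
apply: (abs_summable_le mD (msections_cond_mul i j) _ mh Jh) => w x.
rewrite /g -mulrA normrM ger0_norm ?cond_ge0// -mulrDr ler_wpM2l ?cond_ge0//.
rewrite ler_norml; apply/andP; split; nra.
Qed.

(** The form is the integral of the series of [cond w 0 x] times [(\sum_i v i * F i w x) ^+ 2]. A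
    nonnegative integrand with zero integral vanishes almost everywhere, and then so does each term
    of the series. *)
Lemma quadratic_form_eq0 (v : 'I_d -> R) :
  \sum_i \sum_j v i * v j * fine (cov_dot Q D (F i) (F j)) = 0 ->
  {ae Q, forall w, D w -> forall x, 0 < cond w 0 x -> \sum_i v i * F i w x = 0}.
Proof.
move=> v0.
pose h w x := cond w 0 x * (\sum_i v i * F i w x) ^+ 2.
have h0 w x : 0 <= h w x by rewrite mulr_ge0 ?cond_ge0 ?sqr_ge0.
(* Expanding the square as one sum over pairs of indices makes the linearity of the integral
   applicable. *)
have hE : (fun w x => \sum_(p : 'I_d * 'I_d) (v p.1 * v p.2) * g p.1 p.2 w x) = h.
  apply/funext => w; apply/funext => x.
  rewrite -(pair_bigA _ (fun i j => v i * v j * g i j w x))/= /h expr2.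
  rewrite mulr_suml mulr_sumr; apply: eq_bigr => i _.
  by rewrite !mulr_sumr; apply: eq_bigr => j _; rewrite /g; ring.
have [] := fine_integral_sumZ_sum mD (index_enum (('I_d * 'I_d)%type : finType))
  (fun p => v p.1 * v p.2) (fun p => abs_summable_cond_mul p.1 p.2).
rewrite hE => -[mh Jh].
rewrite (_ : (fun w => sumZ _) = (fun w => \esum_(x in [set: Zd d]) (h w x)%:E)%E); last first.
  apply/funext => w; rewrite -sumZ_ge0; last by move=> x; rewrite lee_fin.
  by congr sumZ; apply/funext => x; rewrite -hE.
rewrite -(pair_bigA _ (fun i j => v i * v j * fine (cov_dot Q D (F i) (F j))))/= v0.
have {}Jh : (\int[Q]_(w in D) (\esum_(x in [set: Zd d]) (h w x)%:E) < +oo)%E.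
  apply: le_lt_trans Jh; rewrite le_eqVlt; apply/orP; left; apply/eqP.
  by apply: eq_integral => w _; apply: eq_esum => x _; rewrite ger0_norm.
move=> /eqP; rewrite fine_eq0; last first.
  by rewrite ge0_fin_numE// integral_esum_ge0.
move=> /eqP J0.
have /(ae_eq_integral_abs Q mD (measurable_esum_fin h0 mh)) : (\int[Q]_(w in D)
    `|\esum_(x in [set: Zd d]) (h w x)%:E|)%E = 0%E.
  rewrite -[RHS]J0; apply: eq_integral => w _.
  by rewrite gee0_abs// esum_ge0// => x _; rewrite lee_fin.
rewrite /ae_eq; apply: filterS => w H Dw x cx.
have : (h w x)%:E = 0%E.
  have HD : (\esum_(x in [set: Zd d]) (h w x)%:E)%E = 0%E by exact: H.
  apply/eqP; rewrite eq_le !lee_fin h0 andbT.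
  have := @le_esum_term _ _ (fun x => (h w x)%:E) x.
  by rewrite HD lee_fin; apply => z; rewrite lee_fin.
by move=> [] /eqP; rewrite mulf_eq0 gt_eqF//= sqrf_eq0 => /eqP.
Qed.

End QuadraticForm.

(** * Triviality of the kernel of [Sigma2] *)

Theorem mainTheorem3 (R : realType) (d : nat) (P : probability (env d R) R)
    (chi : 'I_d -> env d R -> Zd d -> R) (phi : env d R -> 'rV[R]_d) (eps : R) :
  (0 < d)%N ->
  stationary P ->
  ergodic P ->
  {ae P, forall w : env d R, exists! C, infinite_cluster w C} ->
  (\int[P]_w (mu_env w 0) < +oo)%E ->
  (\int[P]_w (\esum_(x in [set: Zd d])
     (cond w 0 x * euclid (\row_j (x 0 j)%:~R) ^+ 2)%:E) < +oo)%E ->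
  is_corrector P chi ->
  (forall j, measurable_fun Omega0 (fun w => phi w 0 j)) ->
  (forall j, L2cov (condP P) Omega0 (grad_infty (fun w => phi w 0 j))) ->
  {ae P, forall w : env d R, Omega0 w -> forall x : Zd d, C_infty w x ->
     forall j, chi j w x = grad (fun w' => phi w' 0 j) w x} ->
  0 <= eps ->
  (\int[P]_w (\esum_(x in [set: Zd d])
     (cond w 0 x * (euclid (phi (tau x w)) ^+ 2 + euclid (phi w) `^ (2 + eps))
        * \1_Omega0 w)%:E) < +oo)%E ->
  Sigma2 P chi \in unitmx.
Proof.
move=> _ statP _ uniqueP _ _ corr mphi _ chiE _ _.
have P0 := probability_Omega0_neq0 statP uniqueP.
(* A square matrix that is not invertible has a nonzero row vector [v] in its left kernel. *)
rewrite -row_free_unit -kermx_eq0; apply/contraT => /rowV0Pn[v /sub_kermxP vS].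
suff -> : v = 0 by rewrite eqxx.
pose l (x : Zd d) : R := \sum_i v 0 i * (x 0 i)%:~R.
suff l0 : forall y, l y = 0.
  (* The value of [l] at the unit vector [delta_mx 0 j] is the coordinate [v 0 j]. *)
  apply/rowP => j; rewrite mxE -(l0 (delta_mx 0 j)) /l (bigD1 j)//= big1.
    by rewrite mxE !eqxx mulr1 addr0.
  by move=> i ij; rewrite mxE eqxx /= (negbTE ij) mulr0.
apply: (linear_gradient_eq0 statP uniqueP (f := fun w => \sum_i v 0 i * phi w 0 i)).
- apply: measurable_sum => i.
  by apply: measurable_funM; [exact: measurable_cst|exact: mphi].
- by move=> x y; rewrite /l -big_split; apply: eq_bigr => i _ /=; rewrite mxE intrD mulrDr.
have mcov i x : measurable_fun setT (harmonic_coord chi i ^~ x).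
  by have [_ [[]]] := corr i.
have quad : {ae P, forall w, Omega0 w -> forall x, 0 < cond w 0 x ->
    \sum_i v 0 i * harmonic_coord chi i w x = 0}.
  apply: (ae_condP P0); apply: quadratic_form_eq0.
  - exact: measurable_Omega0.
  - by move=> i x; exact: measurable_funTS.
  - move=> i; apply: integral_condP_lty => //.
    + apply: measurable_esum => [w x|x].
        by rewrite lee_fin mulr_ge0 ?cond_ge0 ?sqr_ge0.
      apply/measurable_EFinP; apply: measurable_funM; first exact: measurable_cond.
      exact: measurable_funX.
    + by move=> w; apply: esum_ge0 => x _; rewrite lee_fin mulr_ge0 ?cond_ge0 ?sqr_ge0.
    (* The finite norm comes from the membership of the harmonic coordinates in [L2sol]. *)
    + have [_ [[_ _ + _]]] := corr i; apply: le_lt_trans.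
      rewrite le_eqVlt; apply/orP; left; apply/eqP; apply: eq_integral => w _.
      rewrite sumZ_ge0.
        by apply: eq_esum => x _; rewrite expr2 mulrA.
      by move=> x; rewrite lee_fin -mulrA -expr2 mulr_ge0 ?cond_ge0 ?sqr_ge0.
  (* With [j] outermost, the inner sum is coordinate [j] of [v *m Sigma2] times [v 0 j], hence
     zero. *)
  rewrite exchange_big /= big1// => j _.
  have := congr1 (fun u : 'rV[R]_d => u 0 j * v 0 j) vS; rewrite !mxE mul0r mulr_suml => E.
  rewrite -[RHS]E.
  by apply: eq_bigr => i _; rewrite mxE; ring.
move: quad chiE; apply: filterS2 => w quad chiE Ow x cx.
(* An open edge at the origin stays inside the infinite cluster, where [chi] is the gradient of
   [phi]. *)
have Cx : C_infty w x by exact: C_infty_adj Ow cx.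
(* Subtracting the vanishing sum [v . Phi] from [v . x] leaves [v . chi], the gradient of
   [v . phi]. *)
rewrite -[RHS]subr0 -[X in _ = _ - X](quad Ow x cx) -!sumrB.
apply: eq_bigr => i _; rewrite /harmonic_coord (chiE Ow x Cx) /grad.
ring.
Qed.
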